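(* Let $(\Omega,\mathcal{F},\mathbb{P})$ be a complete and nonatomic probability space and let $\{\mathcal{F}_n\}_{n\ge0}$ be a regular stochastic basis such that every $\mathcal{F}_n$ is generated by countably many atoms. Let $0<q_1\le1$, $q_1\le q_2\le\infty$, $q_1\le p_2$, $0<p_1<p_2<\infty$ and $\alpha=\frac1{p_1}-\frac1{p_2}$. Then there exists a constant $C$ such that $$\|I_\alpha f\|_{H_{p_2,q_2}^*}\le C\,\|f\|_{H_{p_1,q_1}^*}$$ for all $f\in H_{p_1,q_1}^*$.
   Context: Setting: a stochastic basis is a nondecreasing sequence $\{\mathcal{F}_n\}_{n\ge 0}$ of sub-$\sigma$-algebras of $\mathcal{F}$ with $\mathcal{F}=\sigma(\bigcup_n\mathcal{F}_n)$. $\mathcal{M}$ is the set of martingales $f=(f_n)_{n\ge0}$ relative to $\{\mathcal{F}_n\}$ with $f_0=0$; $d_kf=f_k-f_{k-1}$; $f^*=\sup_{n\ge0}|f_n|$. Regularity: the stochastic basis is regular if there is an absolute constant $R>0$ such that $g_n\le R\,g_{n-1}$ a.e. for all $n\ge1$ and all nonnegative martingales $g=(g_n)_{n\ge0}$ (here $g_0$ is not required to vanish). Atoms of $\mathcal{F}_n$: a set $B\in\mathcal{F}_n$ (of positive probability) is an atom of $\mathcal{F}_n$ if every $A\subset B$ with $A\in\mathcal{F}_n$ and $\mathbb{P}(A)<\mathbb{P}(B)$ satisfies $\mathbb{P}(A)=0$; $A(\mathcal{F}_n)$ is the set of all atoms in $\mathcal{F}_n$. Fractional integral: for $f\in\mathcal{M}$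 and $\alpha>0$, $I_\alpha f=((I_\alpha f)_n)_{n\ge0}$ is defined by $(I_\alpha f)_n=\sum_{k=1}^n b_{k-1}^\alpha\,d_kf$, where $b_k$ is the $\mathcal{F}_k$-measurable function with $b_k(\omega)=\mathbb{P}(B)$ for all $B\in A(\mathcal{F}_k)$ and $\omega\in B$. Lorentz quasi-norm: $\|h\|_{p,q}=\big(q\int_0^\infty (t\,\mathbb{P}(|h|>t)^{1/p})^q\frac{dt}{t}\big)^{1/q}$ for $0<p,q<\infty$, and $\|h\|_{p,\infty}=\sup_{t>0}t\,\mathbb{P}(|h|>t)^{1/p}$. Hardy–Lorentz space: for $0<p<\infty$, $0<q\le\infty$, $H_{p,q}^*=\{f\in\mathcal{M}:\ \|f\|_{H_{p,q}^*}=\|f^*\|_{p,q}<\infty\}$. *)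

(* Defs.v *)
From HB Require Import structures.
From mathcomp Require Import all_boot all_order all_algebra.
From mathcomp Require Import all_classical all_reals all_analysis.
Set Implicit Arguments.
Unset Strict Implicit.
Unset Printing Implicit Defensive.
Import Order.TTheory GRing.Theory Num.Theory.
Import numFieldNormedType.Exports.

Local Open Scope classical_set_scope.
Local Open Scope ring_scope.
Local Open Scope ereal_scope.

(* Sub-sigma-algebras are represented as plain set systems on T, and random
   variables as genuine functions; as usual, identities between random variables
   and between sigma-algebras are understood modulo P-null sets. *)

Section Defs.
Context d (T : measurableType d) (R : realType) (P : probability T R).

Definition is_atom (G : set_system T) (B : set T) : Prop :=
  [/\ G B, 0 < P B &
      forall A, G A -> A `<=` B -> P A < P B -> P A = 0].

Definition nonatomic : Prop := forall B, ~ is_atom measurable B.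

Definition ae_eq_system (G H : set_system T) : Prop :=
  (forall A, G A -> exists2 B, H B & P.-negligible (A `+` B)) /\
  (forall B, H B -> exists2 A, G A & P.-negligible (A `+` B)).

(* The sigma-algebra generated by the union of the F n is required to be the
   whole sigma-algebra of T only up to null sets: literal equality would be at
   odds with the completeness of P when the F n are countably generated, and it
   is a special case of the condition below. *)
Definition stochastic_basis (F : nat -> set_system T) : Prop :=
  [/\ forall n, sigma_algebra setT (F n),
      forall n, F n `<=` measurable,
      forall m n, (m <= n)%N -> F m `<=` F n &
      ae_eq_system measurable <<s \bigcup_n F n >>].

(* The equality of G with the sigma-algebra generated by D is up to null sets,
   so that G may, but need not, contain all null sets. *)
Definition countably_generated_by_atoms (G : set_system T) : Prop :=
  exists D : set (set T),
    [/\ countable D, D `<=` is_atom G & ae_eq_system G <<s D >>].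

(* G is meant to be a sigma-algebra, so that <<s G >> = G. *)
Definition measurable_wrt (G : set_system T) (f : T -> R) : Prop :=
  measurable_fun setT (f : g_sigma_algebraType G -> R).

(* Y is a version of the conditional expectation E[X | G]. *)
Definition is_cond_exp (G : set_system T) (X Y : T -> R) : Prop :=
  [/\ measurable_wrt G Y,
      P.-integrable setT (EFin \o Y) &
      forall A, G A -> \int[P]_(x in A) (Y x)%:E = \int[P]_(x in A) (X x)%:E].

Definition martingale (F : nat -> set_system T) (f : nat -> T -> R) : Prop :=
  [/\ forall n, measurable_wrt (F n) (f n),
      forall n, P.-integrable setT (EFin \o f n) &
      forall n, is_cond_exp (F n) (f n.+1) (f n)].

Definition null_martingale (F : nat -> set_system T) (f : nat -> T -> R) : Prop :=
  martingale F f /\ {ae P, forall x, f 0%N x = 0%R}.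

Definition regular (F : nat -> set_system T) : Prop :=
  exists2 c : R, (0 < c)%R &
    forall g : nat -> T -> R, martingale F g ->
      (forall n, {ae P, forall x, (0 <= g n x)%R}) ->
      forall n, (1 <= n)%N -> {ae P, forall x, (g n x <= c * g n.-1 x)%R}.

(* b is the sequence of atom probabilities. The value on an atom is prescribed
   almost everywhere because, with the definition of atoms above, distinct atoms
   may overlap in a null set, and an atom modified by a null set of G is still
   an atom; b is thereby determined up to null sets. *)
Definition atom_prob (F : nat -> set_system T) (b : nat -> T -> R) : Prop :=
  forall k, measurable_wrt (F k) (b k) /\
    forall B, is_atom (F k) B -> {ae P, forall x, B x -> (b k x)%:E = P B}.

Definition mdiff (f : nat -> T -> R) (k : nat) (x : T) : R :=
  (f k x - f k.-1 x)%R.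

Definition frac_int (b : nat -> T -> R) (alpha : R) (f : nat -> T -> R) :
    nat -> T -> R :=
  fun n x => (\sum_(1 <= k < n.+1) (b k.-1 x) `^ alpha * mdiff f k x)%R.

Definition maximal (f : nat -> T -> R) (x : T) : \bar R :=
  ereal_sup (range (fun n => `|f n x|%:E)).

(* The value at q = -oo is irrelevant. *)
Definition lorentz (p : R) (q : \bar R) (h : T -> \bar R) : \bar R :=
  match q with
  | r%:E =>
      (r%:E * \int[lebesgue_measure]_(t in `]0%R, +oo[%classic)
         ((t%:E * (P [set x | t%:E < `|h x|]) `^ p^-1) `^ r * (t^-1)%:E)) `^ r^-1
  | +oo =>
      ereal_sup [set t%:E * (P [set x | t%:E < `|h x|]) `^ p^-1
                | t in `]0%R, +oo[%classic]
  | -oo => 0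
  end.

Definition hardy_lorentz_norm (p : R) (q : \bar R) (f : nat -> T -> R) : \bar R :=
  lorentz p q (maximal f).

Definition hardy_lorentz (F : nat -> set_system T) (p : R) (q : \bar R)
    (f : nat -> T -> R) : Prop :=
  null_martingale F f /\ hardy_lorentz_norm p q f < +oo.

End Defs.

(* Main.v *)
Require Import Defs.
From HB Require Import structures.
From mathcomp Require Import all_boot all_order all_algebra.
From mathcomp Require Import all_classical all_reals all_analysis.
From mathcomp Require Import measurable_realfun ring lra.
Set Implicit Arguments.
Unset Strict Implicit.
Unset Printing Implicit Defensive.
Import Order.TTheory GRing.Theory Num.Theory.
Import numFieldNormedType.Exports.

Local Open Scope classical_set_scope.
Local Open Scope ring_scope.

(** Everything happens along the decreasing sequence of atoms that contain a
    given point. Write f* for the maximal function, w(t) = P(f* > t), and b_n(x)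
    for the probability of the atom of F_n around x.

    Since f_n is essentially constant on an atom of F_n, |f_n(x)| > t puts the
    whole atom inside {f* > t}, so that b_n(x) <= w(t) (ae_level_le). Regularity,
    tested on the conditional expectations of an indicator, bounds the
    probability of every part of positive probability of an atom that is visible
    one step later from below by a fixed fraction 1/c of the atom
    (regular_child_lower). Hence b_n <= c b_{n+1}; and at each step either the
    atom around x stays the same, and then the increment of f vanishes
    (ae_no_split), or it loses such a part, and then b_{n+1} <= (1 - 1/c) b_n
    (ae_atom_prob_chain).

    So, with a = alpha, b_n^a |f_{n+1} - f_n| is at most a constant multiple of
    (b_n^a - b_{n+1}^a) |f_{n+1} - f_n| in both cases. Slice the increment at the
    levels e 2^j. The steps at which level j is exceeded satisfy
    b_n <= c w(e 2^j), and the drops of b^a over these steps telescope to at most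
    (c w(e 2^j))^a. This gives, at points where f* <= e 2^J,
    the bound (I f)* <= C S_J with S_J = e (1 + sum_{j < J} 2^j w(e 2^j)^a)
    (transform_le).

    In terms of tails, P((I f)* > t) <= w(e 2^J) as soon as t >= C S_J. On the
    interval between C S_J and C S_{J+1}, whose length is C e 2^J w(e 2^J)^a, the
    Lorentz integrand with exponents (p2, q) therefore integrates, for q <= 1, to
    at most a multiple of (e 2^J w(e 2^J)^(1/p1))^q, because a + 1/p2 = 1/p1. The sum of
    these numbers over J is at most twice the Lorentz integral of w with
    exponents (p1, q) (dyadic_sum_le_tail_integral, tail_integral_level_sum_le).
    Below C e the tail is bounded by 1, which costs a multiple of e^q; this is
    harmless when e is the norm of f. The case q2 = q1 is then settled, and a
    larger q2 follows from the embedding of Lorentz spaces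
    (tail_integral_exponent_le, weak_le_root). *)

(** * Comparing integrals with weighted sums of interval lengths *)

Section Pieces.
Context {R : realType}.
Implicit Types (D : set R) (g : R -> R) (A : nat -> set R) (k : nat -> R).
Local Notation mu := (@lebesgue_measure R).

(** Upper half of a Riemann-sum comparison. Points where g vanishes may lie
    outside all pieces; this is how a tail that ends at a finite height is
    treated. *)
Lemma integral_le_pieces D g A k : measurable D -> measurable_fun D g ->
  (forall t, D t -> 0 <= g t) -> (forall j, measurable (A j)) ->
  (forall j, 0 <= k j) ->
  (forall t, D t -> g t = 0 \/ exists2 j, A j t & g t <= k j) ->
  (\int[mu]_(t in D) (g t)%:E <= \sum_(j <oo) (k j)%:E * mu (A j))%E.
Proof.
move=> mD mg g0 mA k0 gk.
have mk j : measurable_fun D (EFin \o (fun t => k j * \1_(A j) t)).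
  apply/measurable_EFinP; apply: measurable_funM; first exact: measurable_cst.
  exact: measurable_indic.
have mk1 j : measurable_fun D (EFin \o (\1_(A j) : R -> R)).
  by apply/measurable_EFinP; exact: measurable_indic.
have k1_ge0 j t : (0 <= (k j * \1_(A j) t)%:E :> \bar R)%E.
  by rewrite lee_fin mulr_ge0.
apply: (@le_trans _ _
  (\int[mu]_(t in D) \sum_(j <oo) (k j * \1_(A j) t)%:E)%E).
  apply: ge0_le_integral => //.
  - exact/measurable_EFinP.
  - apply: ge0_emeasurable_sum => [j t _ _|j _]; [exact: k1_ge0|exact: mk].
  move=> t Dt; have [->|[j Ajt gkj]] := gk _ Dt.
    by apply: nneseries_ge0 => j _ _; exact: k1_ge0.
  have := @nneseries_lim_ge _ (fun j => (k j * \1_(A j) t)%:E) xpredT 0 j.+1.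
  move=> /(_ (fun j _ _ => k1_ge0 j t)); apply: le_trans.
  rewrite big_nat_recr//= indicE mem_set//= mulr1 -[leLHS]add0e leeD//.
    by apply: sume_ge0.
rewrite integral_nneseries//; apply: lee_nneseries => j _.
  by move=> _; apply: integral_ge0 => t _; exact: k1_ge0.
under eq_integral do rewrite EFinM.
rewrite ge0_integralZl_EFin//; last exact: mk1.
rewrite integral_indic//; last exact: mA.
apply: lee_wpmul2l; first by rewrite lee_fin.
by rewrite le_measure ?inE//; [exact: measurableI (mA j) mD|exact: mA].
Qed.

(** Lower half of the comparison: disjoint pieces charge each point once. *)
Lemma pieces_le_integral D g A k : measurable D -> measurable_fun D g ->
  (forall t, D t -> 0 <= g t) -> (forall j, measurable (A j)) ->
  trivIset setT A -> (forall j, A j `<=` D) -> (forall j, 0 <= k j) ->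
  (forall j t, A j t -> k j <= g t) ->
  (\sum_(j <oo) (k j)%:E * mu (A j) <= \int[mu]_(t in D) (g t)%:E)%E.
Proof.
move=> mD mg g0 mA tA AD k0 kg.
have AD' : \bigcup_j A j `<=` D by apply: bigcup_sub => j _; exact: AD.
have mAU : measurable (\bigcup_j A j) by exact: bigcupT_measurable.
have mgE E : E `<=` D -> measurable E -> measurable_fun E (EFin \o g).
  by move=> ED mE; apply/measurable_EFinP; exact: measurable_funS mg.
apply: (@le_trans _ _ (\int[mu]_(t in \bigcup_j A j) (g t)%:E)%E); last first.
  apply: ge0_subset_integral; [exact: mAU|exact: mD|exact: mgE| |exact: AD'].
  by move=> t Dt; rewrite lee_fin g0.
rewrite ge0_integral_bigcup; [|exact: mA|exact: mgE| |exact: tA]; last first.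
  by move=> t /AD' Dt; rewrite lee_fin g0.
apply: lee_nneseries => j _; first by move=> _; rewrite mule_ge0 ?lee_fin.
rewrite -(integral_cst mu (mA j)); apply: ge0_le_integral.
- exact: mA.
- by move=> t _; rewrite lee_fin.
- exact: measurable_cst.
- exact: (mgE (A j) (AD j)).
- by move=> t At; rewrite lee_fin kg.
Qed.

End Pieces.

(** * The Lorentz integral of a tail function *)

Section TailIntegral.
Context {R : realType}.
Implicit Types (p q s t c e : R) (w h : R -> R).
Local Notation mu := (@lebesgue_measure R).

(** The integral inside the Lorentz quasi-norm, as a functional of the
    function t |-> P(|h| > t) alone. *)
Definition tail_integral p q w : \bar R :=
  (\int[mu]_(t in `]0%R, +oo[) (((t * w t `^ p^-1) `^ q) / t)%:E)%E.

Definition is_tail w := [/\ nonincreasing_fun w,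
  forall t, 0 <= w t & forall t, w t <= 1].

(** Monotonicity of t^(q-1) for q <= 1: this is how the weight t^(q-1) is
    compared with its value at an end of an interval, instead of being
    integrated. *)
Lemma powR_div_nonincreasing q s t : q <= 1 -> 0 < s -> s <= t ->
  t `^ q / t <= s `^ q / s.
Proof.
move=> q1 s0 st; have t0 : 0 < t := lt_le_trans s0 st.
have E (x : R) : 0 < x -> x `^ q / x = (x `^ (1 - q))^-1.
  move=> x0; have xn0 : x != 0 by rewrite gt_eqF.
  rewrite powRB ?xn0 ?implybT//.
  by rewrite powRr1 ?ltW// invf_div.
rewrite !E// lef_pV2 ?posrE ?powR_gt0//.
by apply: ge0_ler_powR; rewrite ?nnegrE ?subr_ge0//; exact: ltW.
Qed.

Lemma measurable_tail_integrand p q w (D : set R) : is_tail w -> measurable D ->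
  D `<=` `]0%R, +oo[ ->
  measurable_fun D (fun t => (t * w t `^ p^-1) `^ q / t).
Proof.
move=> [wni _ _] mD D0.
apply: (@eq_measurable_fun _ _ _ _ D
    (fun t => (t * w t `^ p^-1) `^ q * t `^ (-1))) => [t|].
  rewrite inE => /D0/=; rewrite in_itv/= andbT => t0.
  by rewrite powR_inv1 ?ltW.
apply: measurable_funM; last first.
  exact: (measurable_funS measurableT _ (measurable_powR (-1))).
apply: (measurableT_comp (measurable_powR q)).
apply: measurable_funM; first exact: measurable_id.
by apply: (measurableT_comp (measurable_powR p^-1)); exact: nonincreasing_measurable.
Qed.

Lemma trivIset_itv_steps (a : nat -> R) : nondecreasing_seq a ->
  trivIset setT (fun j => `[a j, a j.+1[%classic).
Proof.
move=> nda; apply: ltn_trivIset => m n mn; apply/seteqP; split=> // t [/=].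
rewrite !in_itv/= => -[/andP[a1 a2] /andP[a3 a4]].
by move: (lt_le_trans a2 (le_trans (nda _ _ mn) a3)); rewrite ltxx.
Qed.

Lemma geometric_eseries_le c z : 0 <= c -> 0 < z -> z < 1 ->
  (\sum_(i <oo) (c * z ^+ i)%:E <= (c / (1 - z))%:E)%E.
Proof.
move=> c0 z0 z1; apply: lime_le.
  by apply: is_cvg_nneseries => n _ _; rewrite lee_fin mulr_ge0// exprn_ge0 ?ltW.
near=> n; rewrite sumEFin lee_fin.
by apply: (@geometric_le_lim _ n c z c0 z0); rewrite gtr0_norm.
Unshelve. all: by end_near. Qed.

(** Between c/2 and c the integrand is at least its value at c, because w and
    t^(q-1) are nonincreasing; the intervals [e 2^(j-1), e 2^j[ are disjoint. *)
Lemma dyadic_sum_le_tail_integral p q w e :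
  0 < p -> 0 < q -> q <= 1 -> is_tail w -> 0 < e ->
  (\sum_(j <oo) ((e * 2 ^+ j * w (e * 2 ^+ j) `^ p^-1) `^ q)%:E <=
   2%:E * tail_integral p q w)%E.
Proof.
move=> p0 q0 q1 wt e0; have [wni w0 w1] := wt.
pose c j := e * 2 ^+ j; have c0 j : 0 < c j by rewrite mulr_gt0 ?exprn_gt0.
pose k j := (c j * w (c j) `^ p^-1) `^ q / c j.
have k0 j : 0 <= k j by rewrite mulr_ge0 ?powR_ge0 ?invr_ge0 ?ltW.
pose a j := c j / 2.
have aS j : a j.+1 = c j by rewrite /a /c exprS; field.
have c2 j : c j = a j + a j by rewrite /a; field.
have nda : nondecreasing_seq a.
  apply/nondecreasing_seqP => j; rewrite aS /a.
  by have := c0 j; lra.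
have a0 j : 0 < a j by rewrite /a divr_gt0.
have E j : (((c j * w (c j) `^ p^-1) `^ q)%:E =
    2%:E * ((k j)%:E * mu `[a j, a j.+1[%classic))%E.
  rewrite lebesgue_measure_itv/= lte_fin aS.
  have -> : a j < c j by rewrite c2 ltrDl.
  rewrite -EFinD -!EFinM /k /a; congr EFin.
  by field; rewrite gt_eqF.
under eq_eseriesr do rewrite E.
rewrite nneseriesZl; last by move=> j _; rewrite mule_ge0 ?lee_fin.
apply: lee_wpmul2l => //; apply: pieces_le_integral => //.
- exact: measurable_tail_integrand.
- move=> t; rewrite /= in_itv/= andbT => t0.
  by rewrite mulr_ge0 ?powR_ge0 ?invr_ge0 ?ltW.
- exact: trivIset_itv_steps.
- move=> j t /=; rewrite !in_itv/= andbT => /andP[+ _].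
  exact: lt_le_trans.
- move=> j t /=; rewrite in_itv/= aS => /andP[at_ tc].
  have t0 : 0 < t by exact: lt_le_trans at_.
  have wj : w (c j) `^ p^-1 <= w t `^ p^-1.
    by apply: ge0_ler_powR; rewrite ?nnegrE ?invr_ge0 ?(ltW p0)//; apply/wni/ltW.
  rewrite /k powRM ?powR_ge0 ?(ltW (c0 j))// powRM ?powR_ge0 ?(ltW t0)//.
  rewrite mulrAC [leRHS]mulrAC ler_pM ?powR_ge0 ?mulr_ge0 ?invr_ge0//.
  - exact: powR_ge0.
  - exact: ltW.
  - exact: powR_div_nonincreasing (ltW tc).
  - by apply: ge0_ler_powR; rewrite ?nnegrE ?powR_ge0 ?(ltW q0).
Qed.

Lemma weak_le_tail_integral p q w e :
  0 < p -> 0 < q -> q <= 1 -> is_tail w -> 0 < e ->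
  (((e * w e `^ p^-1) `^ q)%:E <= 2%:E * tail_integral p q w)%E.
Proof.
move=> p0 q0 q1 wt e0.
apply: (le_trans _ (dyadic_sum_le_tail_integral p0 q0 q1 wt e0)).
have := @nneseries_lim_ge _
  (fun j => ((e * 2 ^+ j * w (e * 2 ^+ j) `^ p^-1) `^ q)%:E) xpredT 0 1.
rewrite big_nat1 expr0 mulr1; apply => j _ _.
by rewrite lee_fin powR_ge0.
Qed.

Lemma itv_step_exists (a : nat -> R) t : a 0%N <= t -> (exists n, t < a n) ->
  exists i, a i <= t < a i.+1.
Proof.
move=> a0 ex; case: (ex_minnP ex) => -[|i] ta mini.
  by move: ta; rewrite ltNge a0.
exists i; rewrite ta andbT leNgt; apply/negP => /mini.
by rewrite ltnn.
Qed.

(** The weight t^(q-1) is integrable at 0 since q > 0: the intervals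
    ]c 2^-(i+1), c 2^-i] contribute a geometric series of ratio 2^-q. *)
Lemma tail_integral_near0_le p q h c :
  0 < p -> 0 < q -> q <= 1 -> is_tail h -> 0 < c ->
  (\int[mu]_(t in `]0%R, c[) (((t * h t `^ p^-1) `^ q) / t)%:E <=
    (c `^ q * ((2^-1 `^ q) / (1 - 2^-1 `^ q)))%:E)%E.
Proof.
move=> p0 q0 q1 ht c0; have [hni h0 h1] := ht.
set z := 2^-1 `^ q.
have z0 : 0 < z by rewrite powR_gt0.
have z1 : z < 1.
  have := @gt0_ltr_powR _ _ q0 2^-1 1; rewrite powR1; apply.
  - by rewrite nnegrE.
  - by rewrite nnegrE.
  - by rewrite invf_lt1 ?ltr1n.
pose d i := c * 2^-1 ^+ i.+1.
have d0 i : 0 < d i by rewrite mulr_gt0 ?exprn_gt0.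
have hp t : 0 <= h t `^ p^-1 <= 1.
  have <- : (1 : R) `^ p^-1 = 1 by rewrite powR1.
  by rewrite powR_ge0 ge0_ler_powR ?nnegrE ?invr_ge0 ?(ltW p0).
have sub0 : `]0%R, c[ `<=` (`]0%R, +oo[ : set R).
  by move=> t /=; rewrite !in_itv/= andbT => /andP[].
have L : (\int[mu]_(t in `]0%R, c[) (((t * h t `^ p^-1) `^ q) / t)%:E <=
  \sum_(i <oo) (d i `^ q / d i)%:E * mu `]d i, (d i + d i)%R]%classic)%E.
  apply: integral_le_pieces => //.
  - exact: measurable_tail_integrand.
  - move=> t /sub0/=; rewrite in_itv/= andbT => t0.
    by rewrite mulr_ge0 ?powR_ge0 ?invr_ge0 ?ltW.
  - by move=> i; rewrite mulr_ge0 ?powR_ge0 ?invr_ge0 ?ltW.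
  move=> t /=; rewrite in_itv/= => /andP[t0 tc]; right.
  have [i /andP[di1 di2]] : exists i, - (c * 2^-1 ^+ i) <= - t < - (c * 2^-1 ^+ i.+1).
    apply: (@itv_step_exists (fun i => - (c * 2^-1 ^+ i))).
      by rewrite expr0 mulr1 lerN2 ltW.
    have /cvgrPdist_lt/(_ _ t0) : geometric c 2^-1 @ \oo --> (0 : R).
      by apply: cvg_geometric; rewrite gtr0_norm ?invf_lt1 ?ltr1n.
    case=> n _ /(_ n (leqnn n)); rewrite /= sub0r normrN gtr0_norm.
      by exists n; rewrite ltrN2.
    by rewrite mulr_gt0 ?exprn_gt0.
  exists i.
    by rewrite /= in_itv/= -ltrN2 di2 /=; move: di1; rewrite lerN2 /d exprS; lra.
  have dt : d i <= t by rewrite -lerN2 ltW.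
  rewrite (le_trans _ (powR_div_nonincreasing q1 (d0 i) dt))//.
  rewrite ler_wpM2r ?invr_ge0 ?(ltW t0)//.
  have /andP[hp0 hp1] := hp t.
  rewrite ge0_ler_powR ?nnegrE ?(ltW t0) ?(ltW q0)//; first exact: mulr_ge0 (ltW t0) _.
  by rewrite ler_piMr// ltW.
apply: (le_trans L).
have E i : ((d i `^ q / d i)%:E * mu `]d i, (d i + d i)%R]%classic =
    (c `^ q * z * z ^+ i)%:E)%E.
  rewrite lebesgue_measure_itv/= lte_fin ltrDl d0 -EFinD -EFinM addrK.
  rewrite divfK ?gt_eqF// /d powRM ?exprn_ge0 ?(ltW c0)//.
  rewrite -mulrA -exprS -(powR_mulrn _ (powR_ge0 _ _ : 0 <= z)) /z powRAC.
  by rewrite powR_mulrn.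
under eq_eseriesr do rewrite E.
rewrite mulrA; apply: geometric_eseries_le => //.
by rewrite mulr_ge0 ?powR_ge0 ?ltW.
Qed.

(** The bound S_J for the transformed martingale off the level set at height
    e 2^J. The term 1 accounts for the part of the increments below e. *)
Definition level_sum e alpha w J : R :=
  e * (1 + \sum_(0 <= j < J) 2 ^+ j * w (e * 2 ^+ j) `^ alpha).

Lemma level_sumS e alpha w J : level_sum e alpha w J.+1 =
  level_sum e alpha w J + e * 2 ^+ J * w (e * 2 ^+ J) `^ alpha.
Proof. by rewrite /level_sum big_nat_recr//=; ring. Qed.

(** The increments of S at most double, so S_J is at least half of its next
    increment: every point of [S_J, S_{J+1}[ is at least half the length of this
    interval. *)
Lemma level_sum_ge e alpha w J : 0 <= alpha -> is_tail w -> 0 < e ->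
  e * 2 ^+ J * w (e * 2 ^+ J) `^ alpha / 2 <= level_sum e alpha w J.
Proof.
move=> al0 [wni w0 w1] e0.
have wa t : 0 <= w t `^ alpha <= 1.
  have <- : (1 : R) `^ alpha = 1 by rewrite powR1.
  by rewrite powR_ge0 ge0_ler_powR ?nnegrE.
case: J => [|J].
  rewrite /level_sum big_geq// expr0 mulr1 addr0 -mulrA ler_wpM2l ?(ltW e0)//.
  by have /andP[] := wa e; lra.
rewrite level_sumS exprS.
have <- : e * 2 ^+ J * w (e * (2 * 2 ^+ J)) `^ alpha =
          e * (2 * 2 ^+ J) * w (e * (2 * 2 ^+ J)) `^ alpha / 2 by field.
rewrite -[leLHS]add0r lerD//.
  rewrite /level_sum mulr_ge0 ?(ltW e0)// addr_ge0// sumr_ge0// => j _.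
  by rewrite mulr_ge0 ?exprn_ge0 ?powR_ge0.
rewrite ler_wpM2l ?mulr_ge0 ?exprn_ge0 ?(ltW e0)//.
rewrite ge0_ler_powR ?nnegrE// wni// ler_pM2l// ler_peMl ?exprn_ge0//.
by rewrite ler1n.
Qed.

Lemma tail_integral_ge0 p q w : (0 <= tail_integral p q w)%E.
Proof.
apply: integral_ge0 => t; rewrite /= in_itv/= andbT => t0.
by rewrite lee_fin mulr_ge0 ?powR_ge0 ?invr_ge0 ?ltW.
Qed.

(** Weak-type bound: for q <= 1 one dyadic block of the integral controls its
    right end point. *)
Lemma weak_le_root p q w (B : R) t :
  0 < p -> 0 < q -> q <= 1 -> is_tail w ->
  (tail_integral p q w <= B%:E)%E -> 0 < t -> t * w t `^ p^-1 <= (2 * B) `^ q^-1.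
Proof.
move=> p0 q0 q1 wt lB t0.
have y0 : 0 <= t * w t `^ p^-1 by rewrite mulr_ge0 ?powR_ge0 ?ltW.
have B0 : 0 <= B by rewrite -lee_fin (le_trans (tail_integral_ge0 _ _ _) lB).
have : (t * w t `^ p^-1) `^ q <= 2 * B.
  rewrite -lee_fin (le_trans (weak_le_tail_integral p0 q0 q1 wt t0))// EFinM.
  by apply: lee_wpmul2l.
move=> yB; have -> : t * w t `^ p^-1 = ((t * w t `^ p^-1) `^ q) `^ q^-1.
  by rewrite -powRrM divff ?gt_eqF// powRr1.
by rewrite ge0_ler_powR ?nnegrE ?invr_ge0 ?powR_ge0 ?mulr_ge0 ?(ltW q0).
Qed.

(** Monotonicity of Lorentz spaces in the second exponent: in
    (t w^(1/p))^r = (t w^(1/p))^(r-q) (t w^(1/p))^q the first factor is bounded by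
    the weak-type estimate. *)
Lemma tail_integral_exponent_le p q r w (B : R) :
  0 < p -> 0 < q -> q <= 1 -> q <= r ->
  is_tail w -> (tail_integral p q w <= B%:E)%E ->
  (tail_integral p r w <= (((2 * B) `^ q^-1) `^ (r - q) * B)%:E)%E.
Proof.
move=> p0 q0 q1 qr wt lB; set M := (2 * B) `^ q^-1.
have weak t : 0 < t -> t * w t `^ p^-1 <= M by exact: weak_le_root.
have M0 : 0 <= M by exact: powR_ge0.
have r0 : 0 < r by exact: lt_le_trans qr.
have mw s : measurable_fun (`]0%R, +oo[ : set R) (fun t => (t * w t `^ p^-1) `^ s / t).
  exact: measurable_tail_integrand.
apply: (@le_trans _ _ ((M `^ (r - q))%:E * tail_integral p q w)%E); last first.
  by rewrite EFinM; apply: lee_wpmul2l => //; rewrite lee_fin powR_ge0.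
rewrite /tail_integral -ge0_integralZl_EFin ?powR_ge0//.
- apply: ge0_le_integral => //.
  + move=> t; rewrite /= in_itv/= andbT => t0.
    by rewrite lee_fin mulr_ge0 ?powR_ge0 ?invr_ge0 ?ltW.
  + by apply/measurable_EFinP; exact: mw.
  + apply/measurable_EFinP; apply: measurable_funM; first exact: measurable_cst.
    exact: mw.
  move=> t; rewrite /= in_itv/= andbT => t0.
  rewrite -EFinM lee_fin mulrA ler_wpM2r ?invr_ge0 ?(ltW t0)//.
  have y0 : 0 <= t * w t `^ p^-1 by rewrite mulr_ge0 ?powR_ge0 ?ltW.
  have [->|yn0] := eqVneq (t * w t `^ p^-1) 0.
    by rewrite powR0 ?gt_eqF// mulr_ge0 ?powR_ge0.
  have -> : (t * w t `^ p^-1) `^ r =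
      (t * w t `^ p^-1) `^ (r - q) * (t * w t `^ p^-1) `^ q.
    by rewrite -powRD ?yn0 ?implybT// subrK.
  rewrite ler_wpM2r ?powR_ge0// ge0_ler_powR ?nnegrE ?subr_ge0//.
  exact: weak.
- move=> t; rewrite /= in_itv/= andbT => t0.
  by rewrite lee_fin mulr_ge0 ?powR_ge0 ?invr_ge0 ?ltW.
- by apply/measurable_EFinP; exact: mw.
Qed.

(** Finiteness of the weak quasi-norm makes the tail tend to 0 at infinity. *)
Lemma vanishing_level w p e (M y : R) : 0 < p -> 0 < e -> 0 <= y ->
  (forall t, 0 < t -> t * w t `^ p^-1 <= M) ->
  (forall J, y <= w (e * 2 ^+ J)) -> y = 0.
Proof.
move=> p0 e0 y0 wM yw; apply/eqP; rewrite eq_le y0 andbT leNgt; apply/negP => yp.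
have z0 : 0 < e * y `^ p^-1 by rewrite mulr_gt0 ?powR_gt0.
have bd J : 2 ^+ J * (e * y `^ p^-1) <= M.
  have t0 : 0 < e * 2 ^+ J by rewrite mulr_gt0 ?exprn_gt0.
  rewrite (le_trans _ (wM _ t0))// mulrCA mulrA ler_wpM2l ?(ltW t0)//.
  by rewrite ge0_ler_powR ?nnegrE ?invr_ge0 ?(ltW p0)// (le_trans y0).
pose n := Num.bound `|M / (e * y `^ p^-1)|.
have := bd n; rewrite -ler_pdivlMr// leNgt => /negP; apply.
have Mn : `|M / (e * y `^ p^-1)| < n%:R by exact: archi_boundP.
rewrite (le_lt_trans (ler_norm _))// (lt_le_trans Mn)//.
by rewrite -natrX ler_nat ltnW// ltn_expl.
Qed.

(** Cut the half line at the points C S_J. Below C S_0 = C e the tail h is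
    only bounded by 1. On [C S_J, C S_{J+1}[ it is at most w(e 2^J), and
    (alpha + 1/p2) = 1/p1 turns the length of the interval times the value of the
    integrand into the J-th dyadic term of the integral of w. Beyond all C S_J,
    if these stay bounded, h vanishes. As t^(q-1) is nonincreasing and S_J is at
    least half of its next increment, only the increments of S, and not S itself,
    enter the sum. *)
Lemma tail_integral_level_sum_le p1 p2 q C e w h : 0 < p1 -> p1 < p2 ->
  0 < q -> q <= 1 -> 0 < C -> 0 < e -> is_tail w -> is_tail h ->
  (forall J t, C * level_sum e (p1^-1 - p2^-1) w J <= t ->
     h t <= w (e * 2 ^+ J)) ->
  (tail_integral p1 q w <= (e `^ q)%:E)%E ->
  (tail_integral p2 q h <=
    (((2^-1 `^ q) / (1 - 2^-1 `^ q) + 4) * (C * e) `^ q)%:E)%E.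
Proof.
move=> p10 p12 q0 q1 C0 e0 wt ht hw lw.
have p20 : 0 < p2 by exact: lt_trans p12.
have [hni h0 h1] := ht; have [wni w0 w1] := wt.
set al := p1^-1 - p2^-1.
have al0 : 0 < al by rewrite subr_gt0 ltf_pV2.
have Ce0 : 0 < C * e by rewrite mulr_gt0.
pose S J := C * level_sum e al w J.
pose x J := e * 2 ^+ J * w (e * 2 ^+ J) `^ al.
have x0 J : 0 <= x J by rewrite !mulr_ge0 ?exprn_ge0 ?powR_ge0 ?(ltW e0).
have S0 : S 0%N = C * e by rewrite /S /level_sum big_geq// addr0 mulr1.
have SS J : S J.+1 = S J + C * x J by rewrite /S level_sumS mulrDr.
have Sge J : C * x J / 2 <= S J.
  by rewrite -mulrA ler_wpM2l ?(ltW C0)//; exact: level_sum_ge (ltW al0) wt e0.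
have ndS : nondecreasing_seq S.
  by apply/nondecreasing_seqP => J; rewrite SS lerDl mulr_ge0// ltW.
have Sgt0 J : 0 < S J by rewrite (lt_le_trans Ce0)// -S0 ndS.
have splitD : `]0%R, +oo[%classic = `]0, C * e[%classic `|` `[C * e, +oo[%classic :> set R.
  apply/seteqP; split => t /=; rewrite !in_itv/= !andbT.
    by case: (ltP t (C * e)) => tC t0; [left; rewrite t0|right].
  by move=> [/andP[]//|]; exact: lt_le_trans.
have dis : [disjoint `]0%R, C * e[%classic & `[C * e, +oo[%classic].
  apply/disj_setPS => t [/=]; rewrite !in_itv/= andbT => /andP[_ tC].
  by rewrite leNgt tC.
have sub1 : `[C * e, +oo[ `<=` (`]0%R, +oo[ : set R).
  by rewrite splitD; exact: subsetUr.
have mh : measurable_fun (`]0%R, +oo[ : set R) (fun t => (t * h t `^ p2^-1) `^ q / t).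
  exact: measurable_tail_integrand.
have pos t : `]0%R, +oo[%classic t -> 0 <= (t * h t `^ p2^-1) `^ q / t.
  rewrite /= in_itv/= andbT => t0.
  by rewrite mulr_ge0 ?powR_ge0 ?invr_ge0 ?ltW.
rewrite /tail_integral splitD ge0_integral_setU//; last 2 first.
- by rewrite -splitD; apply/measurable_EFinP; exact: mh.
- by move=> t; rewrite -splitD => /pos; rewrite lee_fin.
rewrite mulrDl EFinD; apply: leeD.
  by rewrite [X in (_ <= X%:E)%E]mulrC; exact: tail_integral_near0_le.
pose k J := (S J * w (e * 2 ^+ J) `^ p2^-1) `^ q / S J.
have L : (\int[mu]_(t in `[(C * e)%R, +oo[) (((t * h t `^ p2^-1) `^ q) / t)%:E <=
  \sum_(J <oo) (k J)%:E * mu `[S J, S J.+1[%classic)%E.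
  apply: integral_le_pieces => //.
  - exact: measurable_tail_integrand.
  - by move=> t /sub1; exact: pos.
  - by move=> J; rewrite mulr_ge0 ?powR_ge0 ?invr_ge0 ?ltW.
  move=> t Dt; have := sub1 _ Dt; move: Dt; rewrite /= !in_itv/= !andbT => Cet t0.
  have [exn|nex] := pselect (exists n, t < S n); last first.
    (* Here t lies above every C S_J. *)
    left; have -> : h t = 0.
      apply: (vanishing_level (w := w) p10 e0) => //.
        move=> s s0; exact: (weak_le_root p10 q0 q1 wt lw s0).
      move=> J; apply: hw; rewrite leNgt; apply/negP => tS; apply: nex.
      by exists J.
    rewrite powR0 ?mulr0 ?powR0 ?mul0r ?gt_eqF// invr_gt0//.
  right; have [J /andP[SJt tSJ]] := itv_step_exists (eq_ind_r (fun z => z <= t) Cet S0) exn.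
  exists J; first by rewrite /= in_itv/= SJt.
  rewrite /k powRM ?powR_ge0 ?(ltW t0)// powRM ?powR_ge0 ?(ltW (Sgt0 J))//.
  rewrite mulrAC [leRHS]mulrAC ler_pM ?powR_ge0 ?mulr_ge0 ?invr_ge0//.
  - exact: powR_ge0.
  - exact: ltW.
  - exact: powR_div_nonincreasing.
  - rewrite ge0_ler_powR ?nnegrE ?powR_ge0 ?(ltW q0)//.
    by rewrite ge0_ler_powR ?nnegrE ?invr_ge0 ?(ltW p20)//; exact: hw.
apply: (le_trans L).
(* The length C x_J times the integrand at S_J, with S_J >= C x_J / 2. *)
have kS J : ((k J)%:E * mu `[S J, S J.+1[%classic <=
   (2 * C `^ q)%:E * ((e * 2 ^+ J * w (e * 2 ^+ J) `^ p1^-1) `^ q)%:E)%E.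
  have -> : (mu `[S J, S J.+1[%classic = (C * x J)%:E)%E.
    rewrite lebesgue_measure_itv/= lte_fin SS ltrDl.
    case: ltP => [_|]; first by rewrite -EFinD addrAC subrr add0r.
    by rewrite le_eqVlt => /orP[/eqP->//|]; rewrite ltNge mulr_ge0// ltW.
  rewrite -!EFinM lee_fin.
  have [wJ|wJ] := eqVneq (w (e * 2 ^+ J)) 0.
    rewrite /x wJ [_ `^ al]powR0 ?gt_eqF// !mulr0.
    by rewrite !mulr_ge0 ?powR_ge0.
  have wJ0 : 0 < w (e * 2 ^+ J) by rewrite lt_neqAle eq_sym wJ w0.
  have xJ0 : 0 < x J by rewrite !mulr_gt0 ?exprn_gt0 ?powR_gt0.
  have Cx0 : 0 < C * x J by rewrite mulr_gt0.
  have step : S J `^ q / S J <= 2 * ((C * x J) `^ q / (C * x J)).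
    have Cx2 : 0 < C * x J / 2 by rewrite divr_gt0.
    rewrite (le_trans (powR_div_nonincreasing q1 Cx2 (Sge J)))//.
    have -> : (C * x J / 2) `^ q / (C * x J / 2) =
        2 * ((C * x J / 2) `^ q / (C * x J)) by field; rewrite !gt_eqF.
    rewrite ler_wpM2l// ler_wpM2r ?invr_ge0 ?(ltW Cx0)//.
    rewrite ge0_ler_powR ?nnegrE ?(ltW q0) ?(ltW Cx0) ?(ltW Cx2)//.
    by rewrite ler_pdivrMr// ler_peMr ?(ltW Cx0)// ler1n.
  have -> : e * 2 ^+ J * w (e * 2 ^+ J) `^ p1^-1 = x J * w (e * 2 ^+ J) `^ p2^-1.
    rewrite /x -[RHS]mulrA -powRD ?wJ ?implybT//.
    by rewrite /al subrK.
  rewrite /k [X in _ <= _ * X]powRM ?powR_ge0 ?(ltW xJ0)//.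
  rewrite powRM ?powR_ge0 ?(ltW (Sgt0 J))//.
  have -> : S J `^ q * (w (e * 2 ^+ J) `^ p2^-1) `^ q / S J * (C * x J) =
    (S J `^ q / S J) * ((C * x J) * (w (e * 2 ^+ J) `^ p2^-1) `^ q) by ring.
  have -> : 2 * C `^ q * (x J `^ q * (w (e * 2 ^+ J) `^ p2^-1) `^ q) =
    2 * ((C * x J) `^ q / (C * x J)) * ((C * x J) * (w (e * 2 ^+ J) `^ p2^-1) `^ q).
    rewrite [in RHS]powRM ?(ltW C0) ?(ltW xJ0)//.
    by field; rewrite !gt_eqF.
  by rewrite ler_wpM2r// mulr_ge0 ?powR_ge0 ?ltW.
apply: (@le_trans _ _ (\sum_(J <oo)
   (2 * C `^ q)%:E * ((e * 2 ^+ J * w (e * 2 ^+ J) `^ p1^-1) `^ q)%:E)%E).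
  apply: lee_nneseries => J _; last exact: kS.
  by move=> _; rewrite mule_ge0 ?lee_fin// mulr_ge0 ?powR_ge0 ?invr_ge0 ?ltW.
have C2 : 0 <= 2 * C `^ q by rewrite mulr_ge0 ?powR_ge0.
rewrite nneseriesZl; last by move=> J _; rewrite lee_fin powR_ge0.
have -> : 4 * (C * e) `^ q = 2 * C `^ q * (2 * e `^ q).
  by rewrite powRM ?(ltW C0) ?(ltW e0)//; ring.
rewrite [leRHS]EFinM; apply: lee_wpmul2l; first by rewrite lee_fin.
apply: (le_trans (dyadic_sum_le_tail_integral p10 q0 q1 wt e0)).
by rewrite [leRHS]EFinM; apply: lee_wpmul2l.
Qed.

End TailIntegral.

(** * Atoms of a sub-sigma-algebra *)

Section Atoms.
Context d (T : measurableType d) (R : realType) (P : probability T R).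
Implicit Types (G : set_system T) (A B N : set T).

Lemma ae_notin N : measurable N -> P N = 0%E -> {ae P, forall x, ~ N x}.
Proof. by move=> mN N0; exists N; split => // x /= /contrapT. Qed.

(** The bridge between a sigma-algebra given as a set system and the
    measurable-space structure that it generates. *)
Lemma measurable_sub_sigma_algebraE G : sigma_algebra setT G ->
  (measurable : set_system (g_sigma_algebraType G)) = G.
Proof. exact: sigma_algebra_id. Qed.

Section SubAlgebra.
Variable G : set_system T.
Hypothesis sG : sigma_algebra setT G.

Lemma sub_algebraI A B : G A -> G B -> G (A `&` B).
Proof. by rewrite -(measurable_sub_sigma_algebraE sG); exact: measurableI. Qed.

Lemma sub_algebraD A B : G A -> G B -> G (A `\` B).
Proof. by rewrite -(measurable_sub_sigma_algebraE sG); exact: measurableD. Qed.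

Lemma sub_algebraC A : G A -> G (~` A).
Proof. by rewrite -(measurable_sub_sigma_algebraE sG); exact: measurableC. Qed.

Lemma sub_algebra_bigcup (A : nat -> set T) : (forall n, G (A n)) ->
  G (\bigcup_n A n).
Proof.
rewrite -(measurable_sub_sigma_algebraE sG) => mA; exact: bigcupT_measurable.
Qed.

End SubAlgebra.

(** Probabilities as real numbers, so that the arithmetic of atoms can be done
    in an ordered field. *)
Definition pr A : R := fine (P A).

Lemma prE A : measurable A -> P A = (pr A)%:E.
Proof. by move=> mA; rewrite /pr fineK// fin_num_measure. Qed.

Lemma pr_ge0 A : 0 <= pr A. Proof. by rewrite fine_ge0. Qed.

Lemma pr_set0 : pr set0 = 0. Proof. by rewrite /pr measure0. Qed.

Lemma pr_le1 A : measurable A -> pr A <= 1.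
Proof. by move=> mA; rewrite -lee_fin -prE// probability_le1. Qed.

Lemma pr_le A B : measurable A -> measurable B -> A `<=` B -> pr A <= pr B.
Proof. by move=> mA mB AB; rewrite -lee_fin -!prE// le_measure ?inE. Qed.

Lemma pr_split A B : measurable A -> measurable B ->
  pr A = pr (A `\` B) + pr (A `&` B).
Proof.
move=> mA mB; apply: EFin_inj; rewrite EFinD -!prE//.
- exact: measureDI.
- exact: measurableI.
- exact: measurableD.
Qed.

Lemma pr_gt0 A : measurable A -> (0 < P A)%E = (0 < pr A).
Proof. by move=> mA; rewrite prE// lte_fin. Qed.

Lemma pr_eq0 A : measurable A -> P A = 0%E <-> pr A = 0.
Proof. by move=> mA; rewrite prE//; split=> [[]//|->]. Qed.

Lemma prD_trans A B C : measurable A -> measurable B -> measurable C ->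
  pr (A `\` B) = 0 -> pr (B `\` C) = 0 -> pr (A `\` C) = 0.
Proof.
move=> mA mB mC AB BC.
have mAC : measurable (A `\` C) by exact: measurableD.
apply/eqP; rewrite eq_le pr_ge0 andbT (pr_split mAC mB) -[leRHS](addr0 0).
rewrite -{1}AB -BC lerD// pr_le//; try exact: measurableD; try exact: measurableI.
- by move=> x [[]].
- by move=> x [[]].
Qed.

Lemma pr_atom_dichotomy G A B : sigma_algebra setT G -> G `<=` measurable ->
  is_atom P G B -> G A -> pr (A `&` B) = 0 \/ pr (B `\` A) = 0.
Proof.
move=> sG Gm [GB PB atB] GA.
have mA := Gm _ GA; have mB := Gm _ GB.
have mAB : measurable (A `&` B) by exact: measurableI.
have [lt|geAB] := ltP (P (A `&` B)) (P B).
  left; apply/(pr_eq0 mAB); apply: (atB _ _ _ lt); first exact: sub_algebraI.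
  exact: subIsetr.
right; have := pr_split mB mA; rewrite setIC => E.
have := pr_ge0 (B `\` A); rewrite !prE// lee_fin in geAB.
by lra.
Qed.

(** Generating atoms may miss a set Z of positive probability: the generated
    sigma-algebra does not separate points of Z, so Z is then one more atom.
    Adding it when needed yields a sequence of atoms covering almost every
    point. *)
Lemma atoms_cover G : sigma_algebra setT G -> G `<=` measurable ->
  countably_generated_by_atoms P G ->
  exists A : nat -> set T, (forall i, is_atom P G (A i)) /\
    {ae P, forall x, exists i, A i x}.
Proof.
move=> sG Gm [D [cD Dat [GD DG]]].
have DsG : D `<=` G by move=> B /Dat[].
pose Z := ~` \bigcup_(B in D) B.
have GU : G (\bigcup_(B in D) B).
  case: (pfcard_geP cD) => [->|/surjfunPex[f Df]].
    by rewrite bigcup_set0; case: sG.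
  rewrite Df bigcup_image; apply: (sub_algebra_bigcup sG) => n.
  by apply: DsG; rewrite Df; exists n.
have GZ : G Z by exact: sub_algebraC.
have mZ := Gm _ GZ.
(* No set of the generated sigma-algebra cuts Z. *)
have Zdich B : <<s D >> B -> Z `<=` B \/ Z `<=` ~` B.
  pose H := [set B | Z `<=` B \/ Z `<=` ~` B].
  suff : <<s D >> `<=` H by apply.
  apply: smallest_sub.
    split.
    - by right; rewrite setC0.
    - by move=> A [ZA|ZA]; [right|left]; rewrite setTD ?setCK.
    - move=> A HA; have [[n Zn]|nZ] := pselect (exists n, Z `<=` A n).
        by left => x /Zn Ax; exists n.
      right => x Zx [n _ Anx]; have [Zn|Zn] := HA n; first by apply: nZ; exists n.
      exact: Zn Zx Anx.
  by move=> A DA; right => x Zx Ax; apply: Zx; exists A.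
have Zatom : (0 < P Z)%E -> is_atom P G Z.
  move=> PZ; split=> // A GA AZ ltAZ; have mA := Gm _ GA.
  have [B sB [N [mN N0 ABN]]] := GD _ GA.
  have [ZB|ZB] := Zdich _ sB.
    have ZA0 : pr (Z `\` A) = 0.
      apply/(pr_eq0 (measurableD mZ mA)); apply: (subset_measure0 _ mN _ N0).
        exact: measurableD.
      by move=> x [Zx nAx]; apply: ABN; right; split => //; exact: ZB.
    have := pr_split mZ mA; rewrite ZA0 add0r setIC setIidl// => ZA.
    by move: ltAZ; rewrite !prE// ZA ltxx.
  apply: (subset_measure0 mA mN _ N0) => x Ax.
  by apply: ABN; left; split => // Bx; exact: (ZB x (AZ _ Ax)).
case: (pfcard_geP cD) => [D0|/surjfunPex[f Df]].
  have ZT : Z = setT by rewrite /Z D0 bigcup_set0 setC0.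
  exists (fun=> Z); split => [_|].
    by apply: Zatom; rewrite ZT probability_setT lte01.
  by apply: aeW => x; exists 0%N; rewrite ZT.
have fat i : is_atom P G (f i) by apply: Dat; rewrite Df; exists i.
have [PZ|PZ] := pselect (0 < P Z)%E.
  exists (fun n => if n is m.+1 then f m else Z); split => [[|m]//|].
    exact: Zatom.
  apply: aeW => x; have [Zx|] := pselect (Z x); first by exists 0%N.
  by rewrite /Z Df bigcup_image => /contrapT[m _ fmx]; exists m.+1.
exists f; split=> //.
have Z0 : P Z = 0%E.
  by apply/eqP; rewrite eq_le measure_ge0 andbT leNgt; apply/negP.
apply: filterS (ae_notin mZ Z0) => x.
by rewrite /Z Df bigcup_image => /contrapT[m _ fmx]; exists m.
Qed.

End Atoms.

(** * Regularity as a lower bound on children of atoms *)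

Section Regular.
Context d (T : measurableType d) (R : realType) (P : probability T R).
Local Notation pr := (pr P).

(** How a numerical inequality is read off from an almost sure one. *)
Lemma ae_exists (A : set T) (Q : T -> Prop) : measurable A -> 0 < pr A ->
  {ae P, forall x, Q x} -> exists2 x, A x & Q x.
Proof.
move=> mA A0 [N [mN N0 QN]]; apply: contrapT => nex.
have : pr A = 0.
  apply/(pr_eq0 P mA)/(subset_measure0 mA mN _ N0) => x Ax.
  by apply: QN => Qx; apply: nex; exists x.
by move=> A00; rewrite A00 ltxx in A0.
Qed.

Lemma atom_meets (a : nat -> set T) (B : set T) : (forall i, measurable (a i)) ->
  {ae P, forall x, exists i, a i x} -> measurable B -> 0 < pr B ->
  exists i, 0 < pr (B `&` a i).
Proof.
move=> ma cov mB B0; apply: contrapT => nex.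
have nai i : {ae P, forall x, ~ (B `&` a i) x}.
  apply: ae_notin; first exact: measurableI.
  apply/pr_eq0; first exact: measurableI.
  apply/eqP; rewrite eq_le pr_ge0 andbT leNgt; apply/negP => Bai.
  by apply: nex; exists i.
have [x Bx [[i aix] nBa]] := ae_exists mB B0 (filterI cov (ae_foralln nai)).
by apply: (nBa i).
Qed.

Lemma integral_scaled_indic (c : R) (Q A : set T) : 0 <= c -> measurable Q ->
  measurable A ->
  (\int[P]_(x in A) (c * \1_Q x)%:E = (c * pr (Q `&` A))%:E)%E.
Proof.
move=> c0 mQ mA; under eq_integral do rewrite EFinM.
rewrite ge0_integralZl_EFin//.
  by rewrite integral_indic// EFinM -prE//; exact: measurableI.
by apply/measurable_EFinP; exact: measurable_indic.
Qed.

Variables (F : nat -> set_system T) (a : nat -> nat -> set T).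
Hypothesis sF : forall n, sigma_algebra setT (F n).
Hypothesis Fm : forall n, F n `<=` measurable.
Hypothesis Fnd : forall m n, (m <= n)%N -> F m `<=` F n.
Hypothesis aat : forall n i, is_atom P (F n) (a n i).
Hypothesis acov : forall n, {ae P, forall x, exists i, a n i x}.

(** An atom of F_n is contained, up to a null set, in one of the atoms of each
    earlier F_m: it has to meet one of them, and it cannot be cut. *)
Lemma atom_ancestor m n B : (m <= n)%N -> is_atom P (F n) B ->
  exists i, pr (B `\` a m i) = 0.
Proof.
move=> mn Bat; have [FB B0 _] := Bat; have mB := Fm FB.
have Fa k i : F k (a k i) by have [] := aat k i.
have ma i : measurable (a m i) by exact: Fm (Fa m i).
rewrite pr_gt0// in B0.
have [i Bi] := atom_meets ma (acov m) mB B0.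
exists i; have [|//] := pr_atom_dichotomy (sF n) (@Fm n) Bat (Fnd mn (Fa m i)).
by rewrite setIC => Bi0; rewrite Bi0 ltxx in Bi.
Qed.

(** Regularity is applied to g_m = E[1_E | F_m] for E in F_{n+1} inside the atom
    B of F_n. Up to time n, g_m is a multiple of the indicator of the atom of F_m
    around B, and g_n = (P(E)/P(B)) 1_B. At a point of E the inequality
    g_{n+1} <= c g_n reads P(B) <= c P(E). *)
Lemma regular_child_lower : regular P F -> exists2 c, 1 <= c &
  forall n B E, is_atom P (F n) B -> F n.+1 E -> E `<=` B -> 0 < pr E ->
  pr B <= c * pr E.
Proof.
move=> [c0 c00 reg]; exists (Num.max c0 1); first by rewrite le_max lexx orbT.
move=> n B E Bat FE EB PE.
have [FB B0 _] := Bat; have mB := Fm FB; have mE := Fm FE.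
have PB : 0 < pr B by rewrite -pr_gt0.
(* q m is the atom of F_m around B up to time n, and E afterwards. *)
have /choice[q qP] m : exists Q, [/\ F m Q, 0 < pr Q, pr (E `\` Q) = 0,
    (n < m)%N -> Q = E &
    ((m <= n)%N -> is_atom P (F m) Q) /\ (m = n -> Q = B)].
  have [mn|nm] := leqP m n; last first.
    exists E; split => //; first exact: Fnd FE.
      by rewrite setDv pr_set0.
    by split=> // mn; rewrite mn ltnn in nm.
  have [->|mneqn] := eqVneq m n.
    exists B; split => //.
    have -> : E `\` B = set0 by rewrite setD_eq0.
    by rewrite pr_set0.
  have [i Bi] := atom_ancestor mn Bat.
  have [Fa a0 _] := aat m i; have ma := Fm Fa.
  exists (a m i); split => //.
  - by rewrite -pr_gt0.
  - apply/eqP; rewrite eq_le pr_ge0 andbT -[leRHS]Bi pr_le//; try exact: measurableD.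
    by move=> x [Ex nax]; split => //; exact: EB.
  - by split=> // mn'; rewrite mn' eqxx in mneqn.
have mq m : measurable (q m) by have [Fq _ _ _ _] := qP m; exact: Fm Fq.
pose g m x := pr E / pr (q m) * \1_(q m) x.
have ratio0 m : 0 <= pr E / pr (q m) by rewrite divr_ge0 ?pr_ge0.
(* g is the martingale of conditional expectations of the indicator of E. *)
have gint m A : F m A -> (\int[P]_(x in A) (g m x)%:E = (pr (E `&` A))%:E)%E.
  move=> FA; have mA := Fm FA.
  have [Fq q0 Eq qE [qat _]] := qP m.
  rewrite integral_scaled_indic//; congr EFin.
  have [mn|nm] := leqP m n; last by rewrite qE// divff ?mul1r// gt_eqF.
  have [Aq|Aq] := pr_atom_dichotomy (sF m) (@Fm m) (qat mn) FA.
    rewrite setIC Aq mulr0; apply/esym/eqP; rewrite eq_le pr_ge0 andbT.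
    rewrite (pr_split P (measurableI _ _ mE mA) (mq m)) -[leRHS]addr0 -{1}Eq -Aq.
    rewrite lerD// pr_le//; try exact: measurableD; try exact: measurableI.
    - by apply: measurableD => //; exact: measurableI.
    - by move=> x [[]].
    - by apply: measurableI => //; exact: measurableI.
    - by move=> x [[]].
  have := prD_trans mE (mq m) mA Eq Aq => EA.
  have := pr_split P mE mA; rewrite EA add0r => <-.
  have := pr_split P (mq m) mA; rewrite Aq add0r => <-.
  by rewrite divfK// gt_eqF.
have gmart : martingale P F g.
  have mg m : measurable_wrt (F m) (g m).
    have [Fq _ _ _ _] := qP m.
    apply: measurable_funM; first exact: measurable_cst.
    by apply: measurable_indic; rewrite measurable_sub_sigma_algebraE.
  have ig m : P.-integrable setT (EFin \o g m).
    have := integrableZl measurableT (pr E / pr (q m))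
      (integrable_indic P (mq m)).
    by apply: eq_integrable => // x _; rewrite -EFinM.
  split => // m; split => // A FA.
  by rewrite !gint//; exact: Fnd FA.
have gge0 m : {ae P, forall x, 0 <= g m x}.
  by apply: aeW => x; rewrite mulr_ge0.
have [x Ex] := ae_exists mE PE (reg g gmart gge0 n.+1 isT).
have [_ _ _ qE _] := qP n.+1; have [_ _ _ _ [_ qB]] := qP n.
rewrite /g/= qE// qB// divff ?gt_eqF// !indicE !mem_set//; last exact: EB.
rewrite !mulr1 mulrA ler_pdivlMr// mul1r => /le_trans; apply.
by rewrite ler_wpM2r ?pr_ge0// le_max lexx.
Qed.

End Regular.

(** * Almost sure behaviour along a branch of atoms *)

Section Facts.
Context d (T : measurableType d) (R : realType) (P : probability T R).
Local Notation pr := (pr P).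

Section Wrt.
Variable G : set_system T.
Hypothesis sG : sigma_algebra setT G.

Lemma measurable_wrt_lt (f g : T -> R) : measurable_wrt G f -> measurable_wrt G g ->
  G [set x | f x < g x].
Proof.
move=> mf mg; rewrite -(measurable_sub_sigma_algebraE sG).
have := measurable_fun_ltr mf mg => /(_ measurableT [set true] I); rewrite setTI.
exact.
Qed.

Lemma measurable_wrt_norm_gt (f : T -> R) (l : R) : measurable_wrt G f ->
  G [set x | l < `|f x|].
Proof.
move=> mf; apply: measurable_wrt_lt; first exact: measurable_cst.
exact: (measurableT_comp (@normr_measurable _ setT) mf).
Qed.

Lemma measurable_wrtS (H : set_system T) (f : T -> R) : sigma_algebra setT H ->
  G `<=` H -> measurable_wrt G f -> measurable_wrt H f.
Proof.
move=> sH GH mf _ Y mY; have := mf measurableT Y mY.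
by rewrite (measurable_sub_sigma_algebraE sG) (measurable_sub_sigma_algebraE sH) => /GH.
Qed.

Lemma measurable_wrt_measurable (f : T -> R) : G `<=` measurable ->
  measurable_wrt G f -> measurable_fun setT f.
Proof.
move=> Gm mf _ Y mY; have := mf measurableT Y mY.
by rewrite (measurable_sub_sigma_algebraE sG) => /Gm.
Qed.

End Wrt.

(** Two functions with the same integral over B cannot be strictly ordered
    almost everywhere on B. *)
Lemma integral_eq_not_lt (f g : T -> R) (B : set T) : measurable B ->
  measurable_fun setT f -> measurable_fun setT g ->
  P.-integrable setT (EFin \o f) -> P.-integrable setT (EFin \o g) ->
  (\int[P]_(x in B) (f x)%:E = \int[P]_(x in B) (g x)%:E)%E ->
  0 < pr B -> ~ pr (B `\` [set x | g x < f x]) = 0.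
Proof.
move=> mB mf mg iff ifg fg B0 null.
have mgf : measurable [set x | g x < f x].
  have := measurable_fun_ltr mg mf => /(_ measurableT [set true] I); rewrite setTI.
  by exact.
have gtae : {ae P, forall x, B x -> g x < f x}.
  have mN := measurableD mB mgf.
  apply: filterS (ae_notin mN (proj2 (pr_eq0 P mN) null)) => x nx Bx.
  by apply: contrapT => ngf; apply: nx.
have iB h : P.-integrable setT (EFin \o h) -> P.-integrable B (EFin \o h).
  by apply: integrableS.
have ih : (\int[P]_(x in B) ((f x)%:E - (g x)%:E) = 0)%E.
  rewrite integralB_EFin ?iB// fg subee//.
  exact: integrable_fin_num (iB _ ifg).
have mh : measurable_fun B (fun x => ((f x)%:E - (g x)%:E)%E).
  apply: emeasurable_funB; apply/measurable_EFinP; exact: measurable_funTS.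
have /(ae_eq_integral_abs P mB mh) h0 : (\int[P]_(x in B) `|(f x)%:E - (g x)%:E| = 0)%E.
  rewrite -[RHS]ih; apply: ae_eq_integral => //; first exact: measurableT_comp.
  apply: filterS gtae => x /[apply] gf.
  by rewrite gee0_abs// -EFinB lee_fin subr_ge0 ltW.
have [x Bx [gtx eqx]] := ae_exists mB B0 (filterI gtae h0).
have := gtx Bx; have /= := eqx Bx; rewrite -EFinB => -[] /eqP.
by rewrite subr_eq0 => /eqP ->; rewrite ltxx.
Qed.

Variables (F : nat -> set_system T) (a : nat -> nat -> set T) (b : nat -> T -> R).
Hypothesis sF : forall n, sigma_algebra setT (F n).
Hypothesis Fm : forall n, F n `<=` measurable.
Hypothesis Fnd : forall m n, (m <= n)%N -> F m `<=` F n.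
Hypothesis aat : forall n i, is_atom P (F n) (a n i).
Hypothesis acov : forall n, {ae P, forall x, exists i, a n i x}.
Hypothesis bat : atom_prob P F b.

Let Fa n i : F n (a n i). Proof. by have [] := aat n i. Qed.
Let ma n i : measurable (a n i). Proof. exact: Fm (Fa n i). Qed.

Lemma ae_atom_prob : {ae P, forall x, forall n, exists2 i, a n i x & b n x = pr (a n i)}.
Proof.
have bE : {ae P, forall x, forall n i, a n i x -> b n x = pr (a n i)}.
  apply: ae_foralln => n; apply: ae_foralln => i.
  have [_ bB] := bat n; apply: filterS (bB _ (aat n i)) => x /[apply].
  by rewrite prE// => -[].
apply: filterS2 bE (ae_foralln acov) => x bE cov n.
by have [i aix] := cov n; exists i => //; exact: bE.
Qed.

Lemma ae_atoms_meet : {ae P, forall x, forall n i j, a n i x -> a n.+1 j x ->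
  0 < pr (a n i `&` a n.+1 j)}.
Proof.
apply: ae_foralln => n; apply: ae_foralln => i; apply: ae_foralln => j.
have mI := measurableI _ _ (ma n i) (ma n.+1 j).
have [pos|] := ltP 0 (pr (a n i `&` a n.+1 j)); first exact: aeW.
move=> le0; have null : pr (a n i `&` a n.+1 j) = 0.
  by apply/eqP; rewrite eq_le le0 pr_ge0.
apply: filterS (ae_notin mI (proj2 (pr_eq0 P mI) null)) => x nx ax aSx.
by exfalso; apply: nx.
Qed.

Lemma child_atom_sub n i j : 0 < pr (a n i `&` a n.+1 j) ->
  pr (a n.+1 j `\` a n i) = 0.
Proof.
move=> pos; have FS : F n.+1 (a n i) by exact: Fnd (Fa n i).
have [e|//] := pr_atom_dichotomy (sF n.+1) (@Fm n.+1) (aat n.+1 j) FS.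
by rewrite e ltxx in pos.
Qed.

Section Chain.
Variable c : R.
Hypothesis c1 : 1 <= c.
Hypothesis regc : forall n B E, is_atom P (F n) B -> F n.+1 E -> E `<=` B ->
  0 < pr E -> pr B <= c * pr E.

(** Regularity is used twice: on the child atom, which bounds the parent from
    above, and on the rest of the parent, which makes the child smaller by the
    factor 1 - 1/c unless that rest is null. *)
Lemma child_atom_prob n i j : 0 < pr (a n i `&` a n.+1 j) ->
  [/\ pr (a n.+1 j) <= pr (a n i), pr (a n i) <= c * pr (a n.+1 j) &
      pr (a n i `\` a n.+1 j) = 0 \/
      pr (a n.+1 j) <= (1 - c^-1) * pr (a n i)].
Proof.
move=> pos; have c0 : 0 < c by exact: lt_le_trans c1.
set B := a n i; set D := a n.+1 j; rewrite -/B -/D in pos.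
have mB : measurable B := ma n i; have mD : measurable D := ma n.+1 j.
have FB : F n.+1 B by exact: Fnd (Fa n i).
have FD : F n.+1 D := Fa n.+1 j.
have DE : pr D = pr (B `&` D).
  by rewrite (pr_split P mD mB) (child_atom_sub pos) add0r setIC.
have BE := pr_split P mB mD; rewrite -DE in BE.
split.
- by rewrite BE lerDr pr_ge0.
- rewrite DE; apply: regc (aat n i) _ _ pos; last exact: subIsetl.
  exact: (sub_algebraI (sF n.+1)).
have [BD0|BD0] := eqVneq (pr (B `\` D)) 0; [by left|right].
have := regc (aat n i) (sub_algebraD (sF n.+1) FB FD) (@subDsetl _ _ _).
rewrite lt_neqAle eq_sym BD0 pr_ge0 => /(_ isT); rewrite -/B -/D => h.
have : pr B / c <= pr (B `\` D) by rewrite ler_pdivrMr// mulrC.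
by rewrite mulrBl mul1r mulrC; lra.
Qed.

Lemma ae_atom_prob_chain : {ae P, forall x, forall n,
  [/\ 0 < b n x, b n x <= 1, b n.+1 x <= b n x, b n x <= c * b n.+1 x &
      b n.+1 x = b n x \/ b n.+1 x <= (1 - c^-1) * b n x]}.
Proof.
apply: filterS2 ae_atom_prob ae_atoms_meet => x bE meet n.
have [i ax ->] := bE n; have [j aSx ->] := bE n.+1.
have pos := meet n i j ax aSx.
have [le1 le2 alt] := child_atom_prob pos.
split => //.
- by rewrite -pr_gt0//; have [] := aat n i.
- exact: pr_le1.
case: alt => [e|]; [left|by right].
apply/eqP; rewrite eq_le le1 /= (pr_split P (ma n i) (ma n.+1 j)) e add0r.
by apply: pr_le => //; exact: measurableI.
Qed.

End Chain.

(** An atom that does not split carries, at both times, a function which is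
    almost surely constant, and the martingale property makes the two integrals
    over it agree. The two strict orders between f_n and f_{n+1} are excluded
    separately, so that the constants never have to be named. *)
Lemma ae_no_split (f : nat -> T -> R) : martingale P F f ->
  {ae P, forall x, forall n, b n.+1 x = b n x -> f n.+1 x = f n x}.
Proof.
move=> [mf intf cef].
have mfm n : measurable_fun setT (f n) by exact: measurable_wrt_measurable (mf n).
have mfS n : measurable_wrt (F n.+1) (f n) by apply: measurable_wrtS (mf n) => //; exact: Fnd.
have key : {ae P, forall x, forall n i j, pr (a n i `\` a n.+1 j) = 0 ->
    pr (a n.+1 j `\` a n i) = 0 -> a n.+1 j x -> f n.+1 x = f n x}.
  apply: ae_foralln => n; apply: ae_foralln => i; apply: ae_foralln => j.
  set B := a n i; set D := a n.+1 j.
  have mB : measurable B := ma n i; have mD : measurable D := ma n.+1 j.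
  have [BD|nBD] := pselect (pr (B `\` D) = 0); last exact: aeW.
  have [DB|nDB] := pselect (pr (D `\` B) = 0); last exact: aeW.
  have B0 : 0 < pr B by rewrite -pr_gt0//; have [] := aat n i.
  have intE : (\int[P]_(x in B) (f n x)%:E = \int[P]_(x in B) (f n.+1 x)%:E)%E.
    by have [_ _] := cef n; apply; exact: Fa.
  have notin (g h : T -> R) : measurable_wrt (F n.+1) g -> measurable_wrt (F n.+1) h ->
      P.-integrable setT (EFin \o g) -> P.-integrable setT (EFin \o h) ->
      (\int[P]_(x in B) (g x)%:E = \int[P]_(x in B) (h x)%:E)%E ->
      {ae P, forall x, D x -> ~ h x < g x}.
    move=> mg mh ig ih gh.
    have Flt := measurable_wrt_lt (sF n.+1) mh mg.
    have mlt := Fm Flt.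
    have [null|null] := pr_atom_dichotomy (sF n.+1) (@Fm n.+1) (aat n.+1 j) Flt.
      have mI : measurable ([set x | h x < g x] `&` D) by exact: measurableI.
      apply: filterS (ae_notin mI (proj2 (pr_eq0 P mI) null)) => x nx Dx hg.
      exact: nx.
    exfalso; apply: (integral_eq_not_lt mB _ _ ig ih gh B0).
    - exact: measurable_wrt_measurable mg.
    - exact: measurable_wrt_measurable mh.
    - exact: prD_trans BD null.
  apply: filterS2 (notin _ _ (mf n.+1) (mfS n) (intf _) (intf _) (esym intE))
    (notin _ _ (mfS n) (mf n.+1) (intf _) (intf _) intE) => x n1 n2 _ _ Dx.
  by apply/eqP; rewrite eq_le !leNgt; apply/andP; split; apply/negP; [exact: n1|exact: n2].
apply: filterS3 ae_atom_prob ae_atoms_meet key => x bE meet key n.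
have [i ax ->] := bE n; have [j aSx ->] := bE n.+1 => bb.
have DB := child_atom_sub (meet n i j ax aSx).
apply: (key n i j) => //.
have E1 := pr_split P (ma n i) (ma n.+1 j).
have E2 := pr_split P (ma n.+1 j) (ma n i).
by rewrite [_ `&` a n i]setIC DB in E2; lra.
Qed.

(** The level set is in F_n, so an atom of F_n which meets it in positive
    probability is contained in it up to a null set. *)
Lemma ae_level_le (f : nat -> T -> R) (l : R) :
  (forall n, measurable_wrt (F n) (f n)) ->
  {ae P, forall x, forall n, l < `|f n x| -> b n x <= pr [set y | l < `|f n y|]}.
Proof.
move=> mf.
have key : {ae P, forall x, forall n i, a n i x -> l < `|f n x| ->
    pr (a n i) <= pr [set y | l < `|f n y|]}.
  apply: ae_foralln => n; apply: ae_foralln => i.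
  have FL := measurable_wrt_norm_gt (sF n) l (mf n); have mL := Fm FL.
  have [null|null] := pr_atom_dichotomy (sF n) (@Fm n) (aat n i) FL.
    have mI := measurableI _ _ mL (ma n i).
    apply: filterS (ae_notin mI (proj2 (pr_eq0 P mI) null)) => x nx ax lx.
    by exfalso; apply: nx.
  apply: aeW => x _ _; rewrite (pr_split P (ma n i) mL) null add0r.
  by apply: pr_le => //; exact: measurableI.
apply: filterS2 ae_atom_prob key => x bE key n.
by have [i ax ->] := bE n => /(key n i ax).
Qed.

End Facts.

(** * The estimate along one branch *)

Section Pointwise.
Context {R : realType}.

(** The layers 2^j with e 2^j < y add up to 2^(K+1) - 1 where e 2^K is the
    last level below y; the additional 1 makes this a majorant of y / e. *)
Lemma le_dyadic_sum (e y : R) J : 0 <= e -> y <= e * 2 ^+ J ->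
  y <= e * (1 + \sum_(0 <= j < J) 2 ^+ j * (e * 2 ^+ j < y)%R%:R).
Proof.
move=> e0; elim: J => [|J IH] yJ; first by rewrite big_geq// addr0 expr0 in yJ *.
rewrite big_nat_recr//=; case: ltP => [lt|/IH le]; last by rewrite mulr0 addr0.
rewrite mulr1.
have -> : \sum_(0 <= j < J) 2 ^+ j * (e * 2 ^+ j < y)%R%:R = 2 ^+ J - 1 :> R.
  rewrite subrX1 big_mkord (_ : 2 - 1 = 1) ?mul1r; last by ring.
  apply: eq_bigr => j _; rewrite (le_lt_trans _ lt) ?mulr1//.
  by rewrite ler_wpM2l// ler_eXn2l ?ltr1n// ltnW.
rewrite (le_trans yJ)// exprS.
by rewrite le_eqVlt; apply/orP; left; apply/eqP; ring.
Qed.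

Variables (b f : nat -> R) (c al : R).
Hypothesis c1 : 1 <= c.
Hypothesis al0 : 0 < al.
Hypothesis chain : forall n,
  [/\ 0 < b n, b n <= 1, b n.+1 <= b n, b n <= c * b n.+1 &
      b n.+1 = b n \/ b n.+1 <= (1 - c^-1) * b n].
Hypothesis no_split : forall n, b n.+1 = b n -> f n.+1 = f n.

Let c0 : 0 < c. Proof. exact: lt_le_trans c1. Qed.
Let b_gt0 n : 0 < b n. Proof. by have [] := chain n. Qed.
Let bS_le n : b n.+1 <= b n. Proof. by have [] := chain n. Qed.
Let powR_le (x y : R) : 0 <= x -> x <= y -> x `^ al <= y `^ al.
Proof.
by move=> x0 xy; rewrite ge0_ler_powR ?nnegrE ?(ltW al0)// (le_trans x0).
Qed.

(** The reciprocal of the fraction of b_n^alpha which is lost at a split. *)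
Definition split_const (c al : R) := (1 - (1 - c^-1) `^ al)^-1.

Lemma split_const_gt0 : 0 < split_const c al.
Proof.
rewrite invr_gt0 subr_gt0.
have := @gt0_ltr_powR _ _ al0 (1 - c^-1) 1; rewrite powR1; apply.
- by rewrite nnegrE subr_ge0 invf_le1.
- by rewrite nnegrE.
- by rewrite ltrBlDr ltrDl invr_gt0.
Qed.

(** If the atom does not split both sides are 0; otherwise b_n^alpha is
    comparable with its drop. *)
Lemma weighted_diff_le n : b n `^ al * `|f n.+1 - f n| <=
  split_const c al * (b n `^ al - b n.+1 `^ al) * `|f n.+1 - f n|.
Proof.
have [_ _ _ _ [bb|br]] := chain n.
  by rewrite no_split// subrr normr0 !mulr0.
rewrite ler_wpM2r// /split_const mulrC ler_pdivlMr; last first.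
  by rewrite -invr_gt0 split_const_gt0.
rewrite mulrBr mulr1 lerB//.
rewrite mulrC -powRM ?(ltW (b_gt0 n)) ?subr_ge0 ?invf_le1//.
by rewrite powR_le// ltW.
Qed.

(** Truncating b at L leaves the drops over the selected steps unchanged and
    the other ones nonnegative, and the truncated drops telescope. *)
Lemma sum_drop_le (D : nat -> bool) (L : R) n : 0 <= L ->
  (forall k, D k -> b k <= L) ->
  \sum_(0 <= k < n) (b k `^ al - b k.+1 `^ al) * (D k)%:R <= L `^ al.
Proof.
move=> L0 DL; pose m k := Num.min (b k) L.
have m0 k : 0 <= m k by rewrite le_min (ltW (b_gt0 k)) L0.
apply: (@le_trans _ _ (\sum_(0 <= k < n) (- m k.+1 `^ al - - m k `^ al))).
  apply: ler_sum => k _; rewrite opprK [leRHS]addrC.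
  case: (boolP (D k)) => Dk.
    have bL := DL _ Dk; have bSL := le_trans (bS_le k) bL.
    by rewrite mulr1 /m !(min_idPl _).
  rewrite mulr0 subr_ge0 powR_le//.
  by rewrite /m le_min !ge_min lexx bS_le orbT.
rewrite telescope_sumr// opprK addrC lerBlDr.
rewrite (@le_trans _ _ (L `^ al)) ?lerDl ?powR_ge0// powR_le//.
by rewrite ge_min lexx orbT.
Qed.

(** Exchange the sum over time with the sum over the levels e 2^j: at fixed
    level the drops of b^alpha are summed over the steps at which an end point of
    the increment exceeds the level, where b_k <= c w_j. The factor c appears
    because it may be the later end point that exceeds the level. *)
Lemma transform_le (e : R) (w : nat -> R) J n : 0 <= e ->
  (forall k, `|f k| <= e * 2 ^+ J) ->
  (forall j, 0 <= w j) ->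
  (forall k j, e * 2 ^+ j < `|f k| -> b k <= w j) ->
  `|\sum_(0 <= k < n) b k `^ al * (f k.+1 - f k)| <=
  2 * split_const c al * c `^ al *
    (e * (1 + \sum_(0 <= j < J) 2 ^+ j * w j `^ al)).
Proof.
move=> e0 fJ w0 lev.
set K := split_const c al; have K0 : 0 < K := split_const_gt0.
pose y k := Num.max `|f k| `|f k.+1|.
pose D k := b k `^ al - b k.+1 `^ al.
have D0 k : 0 <= D k by rewrite subr_ge0 powR_le// ltW.
pose I j k : R := (e * 2 ^+ j < y k)%R%:R.
have yb k : y k <= e * (1 + \sum_(0 <= j < J) 2 ^+ j * I j k).
  by apply: le_dyadic_sum => //; rewrite ge_max !fJ.
have dy k : `|f k.+1 - f k| <= 2 * y k.
  rewrite (le_trans (ler_normB _ _))// mulr_natl mulr2n lerD//.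
    by rewrite /y le_max lexx orbT.
  by rewrite /y le_max lexx.
have stop j k : e * 2 ^+ j < y k -> b k <= c * w j.
  rewrite /y lt_max => /orP[/lev bw|/lev bw].
    by rewrite (le_trans bw)// ler_peMl.
  have [_ _ _ bc _] := chain k.
  by rewrite (le_trans bc)// ler_wpM2l// ltW.
have b01 : b 0%N `^ al <= 1.
  have <- : (1 : R) `^ al = 1 by rewrite powR1.
  by rewrite powR_le ?(ltW (b_gt0 0%N))//; have [] := chain 0%N.
apply: (@le_trans _ _ (\sum_(0 <= k < n)
    2 * K * e * (D k + \sum_(0 <= j < J) 2 ^+ j * (D k * I j k)))).
  rewrite (le_trans (ler_norm_sum _ _ _))//; apply: ler_sum => k _.
  rewrite normrM (ger0_norm (powR_ge0 _ _)) (le_trans (weighted_diff_le k))//.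
  rewrite -/K -/(D k).
  have -> : 2 * K * e * (D k + \sum_(0 <= j < J) 2 ^+ j * (D k * I j k)) =
     K * D k * (2 * (e * (1 + \sum_(0 <= j < J) 2 ^+ j * I j k))).
    under eq_bigr do rewrite mulrCA.
    by rewrite -mulr_sumr; ring.
  rewrite ler_wpM2l ?mulr_ge0 ?(ltW K0)// (le_trans (dy k))//.
  by rewrite ler_wpM2l.
rewrite -mulr_sumr big_split/= exchange_big/=.
have -> : 2 * K * c `^ al * (e * (1 + \sum_(0 <= j < J) 2 ^+ j * w j `^ al)) =
  2 * K * e * (c `^ al + \sum_(0 <= j < J) 2 ^+ j * (c * w j) `^ al).
  under [in RHS]eq_bigr do rewrite powRM ?(ltW c0)// mulrCA.
  by rewrite -mulr_sumr; ring.
rewrite ler_wpM2l ?mulr_ge0 ?(ltW K0)// lerD//.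
  rewrite (@le_trans _ _ 1)//; last first.
    have <- : (1 : R) `^ al = 1 by rewrite powR1.
    exact: powR_le.
  have b1 k : xpredT k -> b k <= 1 by have [] := chain k.
  have := sum_drop_le n ler01 b1; rewrite powR1.
  by under [in X in X -> _]eq_bigr do rewrite mulr1.
apply: ler_sum => j _; rewrite -mulr_sumr ler_wpM2l ?exprn_ge0//.
apply: sum_drop_le; first by rewrite mulr_ge0 ?(ltW c0).
by move=> k; exact: stop.
Qed.

End Pointwise.

(** * From the pointwise bound to Lorentz norms *)

Section Assembly.
Context d (T : measurableType d) (R : realType) (P : probability T R).
Local Notation pr := (pr P).
Implicit Types (f : nat -> T -> R) (h : T -> \bar R).

Definition tail h (t : R) : R := pr [set x | (t%:E < `|h x|)%E].

Definition level_measurable h :=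
  forall t : R, measurable [set x | (t%:E < `|h x|)%E].

Lemma tail_is_tail h : level_measurable h -> is_tail (tail h).
Proof.
move=> mh; split=> [s t st|t|t]; [|exact: pr_ge0|exact: pr_le1].
by apply: pr_le => // x /=; apply: le_lt_trans; rewrite lee_fin.
Qed.

Lemma lorentzE p q h : level_measurable h ->
  lorentz P p q%:E h = ((q%:E * tail_integral p q (tail h)) `^ q^-1)%E.
Proof.
move=> mh; rewrite /lorentz /tail_integral; congr ((_ * _) `^ _)%E.
apply: eq_integral => t _.
by rewrite prE// poweR_EFin -EFinM poweR_EFin -EFinM.
Qed.

(** The factor q^(-1/q) compensates the normalization of the quasi-norm. *)
Lemma tail_integral_le_of_lorentz p q h e :
  0 < q -> 0 <= e -> level_measurable h ->
  (lorentz P p q%:E h <= e%:E)%E ->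
  (tail_integral p q (tail h) <= ((e * q^-1 `^ q^-1) `^ q)%:E)%E.
Proof.
move=> q0 e0 mh; rewrite lorentzE// => le.
have l0 := tail_integral_ge0 p q (tail h).
have ql0 : (0 <= q%:E * tail_integral p q (tail h))%E by rewrite mule_ge0// lee_fin ltW.
have : (q%:E * tail_integral p q (tail h) <= (e `^ q)%:E)%E.
  rewrite -[leLHS]poweRe1// -(divff (lt0r_neq0 q0)) mulrC poweRrM -poweR_EFin.
  apply: gt0_ler_poweR le; rewrite ?(ltW q0)//.
  - by rewrite in_itv/= poweR_ge0 leey.
  - by rewrite in_itv/= lee_fin e0 leey.
rewrite powRM ?powR_ge0// -powRrM mulVf ?gt_eqF// powRr1 ?invr_ge0 ?(ltW q0)//.
by rewrite -lee_pdivlMl// mulrC EFinM.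
Qed.

(** A bound of order e^q for the integral with exponents (p, q) yields a bound
    of order e for the quasi-norm with any second exponent r >= q. *)
Lemma lorentz_le_of_tail_integral p q (r : \bar R) (k : R) :
  0 < p -> 0 < q -> q <= 1 ->
  (q%:E <= r)%E -> 0 <= k ->
  exists2 C, 0 <= C & forall h (e : R), 0 < e -> level_measurable h ->
    (tail_integral p q (tail h) <= (k * e `^ q)%:E)%E ->
    (lorentz P p r h <= (C * e)%:E)%E.
Proof.
move=> p0 q0 q1 qr k0.
have rootE e : 0 < e -> (2 * (k * e `^ q)) `^ q^-1 = (2 * k) `^ q^-1 * e.
  move=> e0; rewrite mulrA powRM ?mulr_ge0 ?powR_ge0// -powRrM.
  by rewrite divff ?gt_eqF// powRr1 ?(ltW e0).
case: r qr => [r|_|//].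
- rewrite lee_fin => qr; have r0 := lt_le_trans q0 qr.
  exists ((r * (((2 * k) `^ q^-1) `^ (r - q) * k)) `^ r^-1); first exact: powR_ge0.
  move=> h e e0 mh le; have th := tail_is_tail mh.
  have := tail_integral_exponent_le p0 q0 q1 qr th le; set A := (_ `^ (r - q) * k).
  have -> : ((2 * (k * e `^ q)) `^ q^-1) `^ (r - q) * (k * e `^ q) = A * e `^ r.
    rewrite (rootE _ e0) powRM ?powR_ge0 ?(ltW e0)//.
    have -> : e `^ r = e `^ (r - q) * e `^ q.
      by rewrite -powRD ?gt_eqF ?implybT// subrK.
    by rewrite /A; ring.
  have A0 : 0 <= A by rewrite mulr_ge0 ?powR_ge0.
  move=> le'; rewrite lorentzE//.
  have -> : (r * A) `^ r^-1 * e = (r * (A * e `^ r)) `^ r^-1.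
    rewrite mulrA [RHS]powRM ?mulr_ge0 ?powR_ge0 ?(ltW r0)// -powRrM.
    by rewrite divff ?gt_eqF// powRr1 ?(ltW e0).
  rewrite -poweR_EFin; apply: gt0_ler_poweR.
  - by rewrite invr_ge0 ltW.
  - by rewrite in_itv/= leey andbT mule_ge0 ?tail_integral_ge0// lee_fin ltW.
  - by rewrite in_itv/= leey andbT lee_fin !mulr_ge0 ?powR_ge0 ?(ltW r0).
  by rewrite EFinM; apply: lee_wpmul2l => //; rewrite lee_fin ltW.
- exists ((2 * k) `^ q^-1); first exact: powR_ge0.
  move=> h e e0 mh le; have th := tail_is_tail mh.
  apply: ge_ereal_sup => y [t /=]; rewrite in_itv/= andbT => t0 <-.
  rewrite prE// poweR_EFin -EFinM lee_fin.
  have := weak_le_root p0 q0 q1 th le t0.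
  by rewrite rootE.
Qed.

Lemma maximal_gtP f t x :
  (t%:E < `|maximal f x|)%E <-> exists n, t < `|f n x|.
Proof.
have ub n : (`|f n x|%:E <= maximal f x)%E.
  by apply: ereal_sup_ubound; exists n.
have max0 : (0 <= maximal f x)%E by apply: le_trans (ub 0%N); rewrite lee_fin.
rewrite gee0_abs//; split=> [/ereal_sup_gt[_ [n _ <-]]|[n tn]].
  by rewrite lte_fin => tn; exists n.
by apply: lt_le_trans (ub n); rewrite lte_fin.
Qed.

Lemma maximal_level_measurable f : (forall n, measurable_fun setT (f n)) ->
  level_measurable (maximal f).
Proof.
move=> mf t.
have -> : [set x | (t%:E < `|maximal f x|)%E] = \bigcup_n [set x | t < `|f n x|].
  apply/seteqP; split => x /=.
    by move=> /maximal_gtP[n tn]; exists n.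
  by case=> n _ tn; apply/maximal_gtP; exists n.
apply: bigcupT_measurable => n.
have mn : measurable_fun setT (fun x => `|f n x|).
  by apply: measurableT_comp (mf n); exact: normr_measurable.
have := measurable_fun_ltr (measurable_cst t) mn => /(_ measurableT [set true] I).
by rewrite setTI.
Qed.

Lemma pr_le_ae (A B : set T) : measurable A -> measurable B ->
  {ae P, forall x, A x -> B x} -> pr A <= pr B.
Proof.
move=> mA mB AB; rewrite (pr_split P mA mB).
suff -> : pr (A `\` B) = 0.
  by rewrite add0r; apply: pr_le => //; exact: measurableI.
have mD := measurableD mA mB.
apply: contrapT => n0; have D0 : 0 < pr (A `\` B).
  by rewrite lt_neqAle pr_ge0 andbT eq_sym; apply/eqP.
by have [x [Ax nBx] /(_ Ax)] := ae_exists mD D0 AB.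
Qed.

(** Stated with an arbitrary positive upper bound e of the norm, which is the
    base level of the dyadic decomposition; this covers martingales of norm 0 as
    well. *)
Theorem frac_int_lorentz_le (F : nat -> set_system T) (b : nat -> T -> R)
    (p1 p2 q1 alpha : R) (q2 : \bar R) :
  stochastic_basis P F -> regular P F ->
  (forall n, countably_generated_by_atoms P (F n)) -> atom_prob P F b ->
  0 < q1 -> q1 <= 1 -> (q1%:E <= q2)%E -> 0 < p1 -> p1 < p2 ->
  alpha = p1^-1 - p2^-1 ->
  exists2 C : R, 0 <= C & forall f (e : R), martingale P F f -> 0 < e ->
    (hardy_lorentz_norm P p1 q1%:E f <= e%:E)%E ->
    (hardy_lorentz_norm P p2 q2 (frac_int b alpha f) <= (C * e)%:E)%E.
Proof.
move=> [sF Fm Fnd _] reg Fat bat q10 q11 q12 p10 p12 alphaE.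
have al0 : 0 < alpha by rewrite alphaE subr_gt0 ltf_pV2 ?posrE ?(lt_trans p10 p12).
have /choice[a aP] n := atoms_cover (sF n) (@Fm n) (Fat n).
have aat n i : is_atom P (F n) (a n i) by have [] := aP n.
have acov n : {ae P, forall x, exists i, a n i x} by have [] := aP n.
have [c c1 regc] := regular_child_lower sF Fm Fnd aat acov reg.
have chain := ae_atom_prob_chain sF Fm Fnd aat acov bat c1 regc.
have nosplit := ae_no_split sF Fm Fnd aat acov bat.
have p20 : 0 < p2 := lt_trans p10 p12.
pose D := 2 * split_const c alpha * c `^ alpha.
have c0 : 0 < c by exact: lt_le_trans c1.
have D0 : 0 < D by rewrite !mulr_gt0 ?split_const_gt0 ?powR_gt0.
(* The tail integral of f is bounded by (e s)^q1, so e s is the base level. *)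
pose s := q1^-1 `^ q1^-1.
have s0 : 0 < s by rewrite powR_gt0 ?invr_gt0.
pose k := ((2^-1 `^ q1) / (1 - 2^-1 `^ q1) + 4) * (D * s) `^ q1.
have k0 : 0 <= k.
  rewrite mulr_ge0 ?powR_ge0// addr_ge0// divr_ge0 ?powR_ge0// subr_ge0.
  have one : (1 : R) `^ q1 = 1 by rewrite powR1.
  rewrite -[leRHS]one; apply: ge0_ler_powR; rewrite ?nnegrE//; first exact: ltW.
  by lra.
have [C C0 HC] := lorentz_le_of_tail_integral p20 q10 q11 q12 k0.
exists C => // f e fmart e0 fe.
have [mf intf _] := fmart.
have mfm n : measurable_fun setT (f n).
  exact: measurable_wrt_measurable (sF n) _ (@Fm n) (mf n).
have mbm n : measurable_fun setT (b n).
  by have [mb _] := bat n; exact: measurable_wrt_measurable (sF n) _ (@Fm n) mb.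
have mg n : measurable_fun setT (frac_int b alpha f n).
  apply: measurable_sum => i; apply: measurable_funM.
    exact: (measurableT_comp (measurable_powR alpha) (mbm _)).
  exact: measurable_funB.
have mF := maximal_level_measurable mfm; have mG := maximal_level_measurable mg.
apply: HC => //.
have es0 : 0 < e * s by rewrite mulr_gt0.
have -> : k * e `^ q1 = ((2^-1 `^ q1) / (1 - 2^-1 `^ q1) + 4) * (D * (e * s)) `^ q1.
  rewrite /k -mulrA -powRM ?(ltW e0) ?(ltW (mulr_gt0 D0 s0))//.
  by rewrite -mulrA [s * e]mulrC.
apply: (tail_integral_level_sum_le (p1 := p1) (w := tail (maximal f))) => //.
- exact: tail_is_tail.
- exact: tail_is_tail.
- rewrite -alphaE => J t DSt; apply: pr_le_ae => //.
  have lev : {ae P, forall x, forall j n, e * s * 2 ^+ j < `|f n x| ->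
      b n x <= pr [set y | e * s * 2 ^+ j < `|f n y|]}.
    by apply: ae_foralln => j; exact: (ae_level_le sF Fm aat acov bat).
  apply: filterS3 chain (nosplit _ fmart) lev => x chainx nosplitx levx.
  move=> /maximal_gtP[n tg]; apply: contrapT => /maximal_gtP nF.
  have fJ i : `|f i x| <= e * s * 2 ^+ J.
    by rewrite leNgt; apply/negP => lt; apply: nF; exists i.
  have levw i j : e * s * 2 ^+ j < `|f i x| ->
      b i x <= tail (maximal f) (e * s * 2 ^+ j).
    move=> lt; rewrite (le_trans (levx j i lt))//; apply: pr_le => //.
      by apply: (@Fm i); exact: measurable_wrt_norm_gt.
    by move=> y /= yl; apply/maximal_gtP; exists i.
  have := @transform_le _ (fun n => b n x) (fun n => f n x) c alpha c1 al0 chainx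
    nosplitx (e * s) (fun j => tail (maximal f) (e * s * 2 ^+ j)) J n (ltW es0) fJ
    (fun j => pr_ge0 _ _) levw.
  move: tg; rewrite /frac_int big_add1/= => tg H.
  by have := lt_le_trans tg (le_trans H DSt); rewrite ltxx.
- exact: tail_integral_le_of_lorentz (ltW e0) mF fe.
Qed.

End Assembly.

Theorem theorem6p4 (d : measure_display) (T : measurableType d) (R : realType)
    (P : probability T R) (F : nat -> set_system T) (b : nat -> T -> R)
    (p1 p2 q1 alpha : R) (q2 : \bar R)
    (P_complete : measure_is_complete P)
    (P_nonatomic : nonatomic P)
    (F_basis : stochastic_basis P F)
    (F_regular : regular P F)
    (F_atoms : forall n, countably_generated_by_atoms P (F n))
    (b_atom : atom_prob P F b)
    (q1_gt0 : 0 < q1) (q1_le1 : q1 <= 1)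
    (q1_le_q2 : (q1%:E <= q2)%E) (q1_le_p2 : q1 <= p2)
    (p1_gt0 : 0 < p1) (p1_lt_p2 : p1 < p2)
    (alphaE : alpha = 1 / p1 - 1 / p2) :
  exists C : R, forall f : nat -> T -> R, hardy_lorentz P F p1 q1%:E f ->
    (hardy_lorentz_norm P p2 q2 (frac_int b alpha f)
       <= C%:E * hardy_lorentz_norm P p1 q1%:E f)%E.
Proof.
rewrite !div1r in alphaE.
have [C C0 HC] := frac_int_lorentz_le F_basis F_regular F_atoms b_atom
  q1_gt0 q1_le1 q1_le_q2 p1_gt0 p1_lt_p2 alphaE.
exists C => f [[fmart _]]; set N := hardy_lorentz_norm _ p1 _ _ => Nlty.
have N0 : (0 <= N)%E by exact: poweR_ge0.
have NE : N = (fine N)%:E by rewrite fineK// ge0_fin_numE.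
(* The norm of f may be 0, which is no admissible level. *)
apply/lee_addgt0Pr => eps eps0.
have C1 : 0 < C + 1 by rewrite ltr_wpDl.
pose e := fine N + eps / (C + 1).
have eps1 : 0 < eps / (C + 1) by rewrite divr_gt0.
have e0 : 0 < e by rewrite ltr_wpDl ?fine_ge0.
have Ne : (N <= e%:E)%E by rewrite NE lee_fin lerDl ltW.
apply: le_trans (HC f e fmart e0 Ne) _.
rewrite NE -EFinM -EFinD lee_fin mulrDr lerD2l.
by rewrite mulrA ler_pdivrMr// mulrC ler_wpM2l ?(ltW eps0)// lerDl.
Qed.
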